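(* The shift space $\mathbb{Y}\subset\{0,1\}^\infty$ (defined in the context) has the average shadowing property but does not have the almost specification property.
   Context: For a finite set $\mathcal{A}$ with the discrete topology, $\mathcal{A}^\infty$ is the product space of sequences indexed by nonnegative integers, with shift $\sigma(\omega)_i=\omega_{i+1}$. A shift space is a nonempty closed $\sigma$-invariant subset, regarded as a dynamical system under $\sigma$. Construction of $\mathbb{Y}$. Let $1<s<t$ be integers. Let $\mathcal{G}^{(s,t)}$ be the directed labelled graph with labels in $\{0,\diamondsuit\}$, vertices $v_0,\dots,v_{t-s},w_0,\dots,w_{s-1}$ and edges: $e_i$ from $v_{i-1}$ to $v_i$ labelled $\diamondsuit$ ($1\le i\le t-s$); $e_i'$ from $w_{i-1}$ to $w_i$ labelled $0$ ($1\le i\le s-1$); $\hat e_1$ from $v_{t-s}$ to $w_0$ labelled $\diamondsuit$; $\hat e_2$ from $v_{t-s}$ to $w_1$ labelled $0$; $\hat e_3$ from $w_{s-1}$ to $v_0$ labelled $0$. Let $X_{(s,t)}\subset\{0,\diamondsuit\}^\infty$ be the set of label sequences of infinite paths on $\mathcal{G}^{(s,t)}$ (so its elements are concatenations of blocks of $s$ zeros separated by blocks of $t-s$ or $t-s+1$ symbols $\diamondsuit$). Put $$F^{(s,t)}=\{x\in\{0,1\}^\infty:\ \text{there exists } y\in X_{(s,t)}\text{ such that if } y_i=0\text{ then } x_i=0\}.$$ With $s_i=2^i$ and $t_i=10^i$, define $\mathbb{Y}=\bigcap_{i=1}^\infty F^{(s_i,t_i)}$. Average shadowing. For a system $(X,T)$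 ($X$ compact metric with metric $\rho$, $T$ continuous), a sequence $\{x_n\}_{n=0}^\infty$ in $X$ is a $\delta$-average pseudoorbit if there is an integer $N_0>0$ such that $\frac1N\sum_{n=0}^{N-1}\rho(T(x_{n+k}),x_{n+k+1})<\delta$ for every $N>N_0$ and $k\ge0$. It is $\varepsilon$-shadowed in average by $x\in X$ if $\limsup_{N\to\infty}\frac1N\sum_{n=0}^{N-1}\rho(T^n(x),x_n)<\varepsilon$. $(X,T)$ has the average shadowing property if for every $\varepsilon>0$ there is $\delta>0$ such that every $\delta$-average pseudoorbit is $\varepsilon$-shadowed in average by some point of $X$. Almost specification. A mistake function is a map $g\colon\mathbb{N}\times(0,\varepsilon_0)\to\mathbb{N}_0$, where $\varepsilon_0>0$, such that for all $\varepsilon<\varepsilon_0$ and $n\in\mathbb{N}$ one has $g(n,\varepsilon)\le g(n+1,\varepsilon)$, and $g(n,\varepsilon)/n\to0$ as $n\to\infty$. Put $k_g(\varepsilon)=\min\{n\in\mathbb{N}: g(m,\varepsilon)<m\varepsilon\text{ for all }m\ge n\}$ and $B_n(g;x,\varepsilon)=\{y\in X:\#\{0\le j<n:\rho(T^j(x),T^j(y))<\varepsilon\}\ge n-g(n,\varepsilon)\}$. $(X,T)$ has the almost specification property if there is a mistake function $g$ such that for every $m\ge1$, all $\varepsilon_1,\dots,\varepsilon_m\in(0,\varepsilon_0)$, all $x_1,\dots,x_m\in X$ and all $n_1\ge k_g(\varepsilon_1),\dots,n_m\ge k_g(\varepsilon_m)$, setting $n_0=0$ and $l_j=\sum_{s=0}^{j-1}n_s$,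 there is $z\in X$ with $T^{l_j}(z)\in B_{n_j}(g;x_j,\varepsilon_j)$ for every $j=1,\dots,m$. *)

(* Defs.v *)
From HB Require Import structures.
From mathcomp Require Import all_boot all_order all_algebra.
From mathcomp Require Import all_classical all_reals all_analysis.
Set Implicit Arguments.
Unset Strict Implicit.
Unset Printing Implicit Defensive.
Import Order.TTheory GRing.Theory Num.Theory.
Import numFieldNormedType.Exports.
Local Open Scope classical_set_scope.
Local Open Scope ring_scope.

(* {0,1}^oo is [cantor_space], i.e. bool^nat with the product topology;
   the symbol 0 is [false] and the symbol 1 is [true]. *)

Definition left_shift (w : cantor_space) : cantor_space := fun i => w i.+1.

Definition shift_space (Y : set cantor_space) : Prop :=
  [/\ Y !=set0, closed Y & forall w, Y w -> Y (left_shift w)].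

Inductive label := Zero | Diamond.

Inductive vertex := V of nat | W of nat.

(* [st_edge s t u a v]: there is an edge labelled a from u to v. The vertices
   of the graph are V 0, ..., V (t - s) and W 0, ..., W (s - 1); other indices
   give isolated vertices, through which no path passes. *)
Inductive st_edge (s t : nat) : vertex -> label -> vertex -> Prop :=
| edge_v i : (1 <= i <= t - s)%N -> st_edge s t (V i.-1) Diamond (V i)
| edge_w i : (1 <= i <= s - 1)%N -> st_edge s t (W i.-1) Zero (W i)
| edge_hat1 : st_edge s t (V (t - s)) Diamond (W 0)
| edge_hat2 : st_edge s t (V (t - s)) Zero (W 1)
| edge_hat3 : st_edge s t (W (s - 1)) Zero (V 0).

Definition X_st (s t : nat) : set (nat -> label) :=
  [set y | exists p : nat -> vertex, forall n, st_edge s t (p n) (y n) (p n.+1)].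

Definition F_st (s t : nat) : set cantor_space :=
  [set x | exists2 y, X_st s t y & forall i, y i = Zero -> x i = false].

Definition YY : set cantor_space :=
  \bigcap_(i in [set i : nat | (1 <= i)%N]) F_st (2 ^ i)%N (10 ^ i)%N.

(* Systems (X, T) are given by a subset X of an ambient type, a map T of that
   type (used only for T(X) included in X), and a distance rho, of which only
   the values on X matter. *)

Definition metric_on (R : realType) (T : Type) (X : set T) (rho : T -> T -> R)
    : Prop :=
  [/\ forall x y, X x -> X y -> 0 <= rho x y,
      forall x y, X x -> X y -> (rho x y = 0 <-> x = y),
      forall x y, X x -> X y -> rho x y = rho y x &
      forall x y z, X x -> X y -> X z -> rho x z <= rho x y + rho y z].

(* rho induces on X the subspace topology. *)
Definition compatible_on (R : realType) (T : topologicalType) (X : set T)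
    (rho : T -> T -> R) : Prop :=
  forall x, X x -> forall U : set T,
    within X (nbhs x) U <->
    exists2 e : R, 0 < e & forall y, X y -> rho x y < e -> U y.

Section Dynamics.
Context {R : realType} {T : Type}.
Variables (X : set T) (f : T -> T) (rho : T -> T -> R).

Definition average_pseudoorbit (delta : R) (x : nat -> T) : Prop :=
  (forall n, X (x n)) /\
  exists N0 : nat, (0 < N0)%N /\
    forall N k : nat, (N0 < N)%N ->
      N%:R^-1 * \sum_(n < N) rho (f (x (n + k)%N)) (x (n + k + 1)%N) < delta.

Definition average_shadowed (eps : R) (x : nat -> T) (z : T) : Prop :=
  (limn_esup (fun N : nat =>
     (N%:R^-1 * \sum_(n < N) rho (iter n f z) (x n))%:E) < eps%:E)%E.

Definition average_shadowing : Prop :=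
  forall eps : R, 0 < eps ->
    exists2 delta : R, 0 < delta &
      forall x : nat -> T, average_pseudoorbit delta x ->
        exists2 z, X z & average_shadowed eps x z.

(* Only the values g n eps with 1 <= n and 0 < eps < eps0 are relevant. *)
Definition mistake_function (eps0 : R) (g : nat -> R -> nat) : Prop :=
  0 < eps0 /\
  forall eps : R, 0 < eps < eps0 ->
    (forall n : nat, (1 <= n)%N -> (g n eps <= g n.+1 eps)%N) /\
    (fun n : nat => (g n eps)%:R / n%:R : R) @ \oo --> (0 : R).

Definition few_mistakes_from (g : nat -> R -> nat) (eps : R) (n : nat) : Prop :=
  (1 <= n)%N /\ forall m : nat, (n <= m)%N -> (g m eps)%:R < m%:R * eps.

(* The least n such that [few_mistakes_from g eps n]; such an n exists as soon
   as g is a mistake function and eps is in its domain. *)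
Definition k_mistake (g : nat -> R -> nat) (eps : R) : nat :=
  get [set n | few_mistakes_from g eps n /\
               forall m, few_mistakes_from g eps m -> (n <= m)%N].

Definition mistake_ball (g : nat -> R -> nat) (n : nat) (x : T) (eps : R)
    : set T :=
  [set y | X y /\
    (n - g n eps <= #|[pred j : 'I_n | (rho (iter j f x) (iter j f y) < eps)%R]|)%N].

(* The indices 1, ..., m are renumbered 0, ..., m - 1. *)
Definition almost_specification : Prop :=
  exists (eps0 : R) (g : nat -> R -> nat), mistake_function eps0 g /\
    forall (m : nat) (eps : 'I_m -> R) (x : 'I_m -> T) (n : 'I_m -> nat),
      (1 <= m)%N ->
      (forall j, 0 < eps j < eps0) ->
      (forall j, X (x j)) ->
      (forall j, (k_mistake g (eps j) <= n j)%N) ->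
      exists2 z, X z & forall j : 'I_m,
        mistake_ball g (n j) (x j) (eps j)
          (iter (\sum_(i < m | (i < j)%N) n i)%N f z).

End Dynamics.

(* Main.v *)
Require Import Defs.
From mathcomp Require Import all_boot all_order all_algebra.
From mathcomp Require Import all_classical all_reals all_analysis.
From mathcomp Require Import zify ring lra.
Set Implicit Arguments.
Unset Strict Implicit.
Unset Printing Implicit Defensive.
Import Order.TTheory GRing.Theory Num.Theory.
Import numFieldNormedType.Exports.
Local Open Scope classical_set_scope.
Local Open Scope ring_scope.

(* A sequence of [F_st s t] is cut by a clock running through cycles of length t or
   t + 1, during the first s units of which the sequence vanishes. As t and t + 1
   are coprime, two such clocks can be joined after any fixed large number of steps.
   Average shadowing: the first symbols of a pseudoorbit form a sequence w most of
   whose windows of length M are words of YY. For the finitely many i <= i0, the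
   clocks of these words are joined at the cost of a small density of erased ones;
   for i > i0, w is erased along the zeros of a periodic clock, which have density
   at most 5^(-i0) in total. The result lies in YY, which is hereditary.
   No almost specification: a point of YY whose prefixes have at least three quarters
   of ones has prefixes u of length 2^(i-1), but any long concatenation of approximate
   copies of u in YY contains 2^i consecutive zeros, hence a copy that is all zero. *)

(** * Clocks and the description of [F_st] by their phases *)

(** A phase below t may climb by one, and the phases t - 1 and t may restart at 0: these two
    restarts give the cycles of length t and t + 1. *)
Definition phase_step (t a b : nat) : bool :=
  ((a < t) && (b == a.+1) || (b == 0) && ((a == t.-1) || (a == t)))%N.

Definition phases (t : nat) (u : nat -> nat) : Prop :=
  (u 0 <= t)%N /\ forall n, phase_step t (u n) (u n.+1).

Lemma phases_le t u n : phases t u -> (u n <= t)%N.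
Proof.
move=> [u0 us]; elim: n => // n _.
by have := us n; rewrite /phase_step; lia.
Qed.

Lemma phases_shift t u k : phases t u -> phases t (fun n => u (n + k)%N).
Proof. by move=> hu; split; [exact: phases_le|move=> n; apply: hu.2]. Qed.

Lemma phases_modn t k : (1 < t)%N -> phases t (fun n => (n + k) %% t)%N.
Proof.
move=> t1; split=> [|n]; first by apply/ltnW; rewrite ltn_mod; lia.
have h := ltn_pmod (n + k) (ltnW t1).
have -> : ((n.+1 + k) %% t = ((n + k) %% t).+1 %% t)%N.
  by rewrite addSn -addn1 -modnDml addn1.
rewrite /phase_step; have [->|ne] := eqVneq ((n + k) %% t)%N t.-1.
  by rewrite prednK ?modnn//; lia.
by rewrite (@modn_small _.+1); lia.
Qed.

(* The edges of the graph are in bijection with the phases 0, ..., t, where the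
   two edges leaving V (t - s) have phases t and 0, except that phase 0 is
   shared by the edges labelled 0 that enter W 1. *)
Definition edge_phase (s : nat) (v : vertex) (a : label) : nat :=
  match v, a with
  | W i, _ => i
  | V _, Zero => 0
  | V i, Diamond => s + i
  end.

Lemma edge_phase_step s t u a v b w : (1 < s < t)%N ->
  st_edge s t u a v -> st_edge s t v b w ->
  phase_step t (edge_phase s u a) (edge_phase s v b).
Proof.
move=> st; case=> [i hi|i hi|||] E; inversion E; rewrite /phase_step /=; lia.
Qed.

Lemma edge_phase_lt s t u a v :
  st_edge s t u a v -> (edge_phase s u a < s)%N -> a = Zero.
Proof. by case=> //= *; lia. Qed.

Lemma F_stP s t (x : cantor_space) : (1 < s < t)%N ->
  F_st s t x <->
  exists2 u, phases t u & forall n, (u n < s)%N -> x n = false.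
Proof.
move=> st; split.
  case=> y [p hp] hy; exists (fun n => edge_phase s (p n) (y n)).
    split=> [|n]; last exact: edge_phase_step (hp n) (hp n.+1).
    by case: (hp 0) => //= *; lia.
  by move=> n hn; apply/hy/(edge_phase_lt (hp n)).
case=> u hu hx.
(* Phase 0 alone does not determine the vertex: it is [V (t - s)] after phase t - 1 and [W 0] after
   phase t, with [W 0] also chosen at time 0. *)
pose p n := if u n is a.+1 then if (a.+1 < s)%N then W a.+1 else V (a.+1 - s)
  else if n is m.+1 then if u m == t.-1 then V (t - s) else W 0 else W 0.
exists (fun n => if (u n < s)%N then Zero else Diamond); last first.
  by move=> n; case: ifP => // /hx.
exists p => n; have := hu.2 n; have := phases_le n hu; rewrite /phase_step.
have pn : p n = if u n is a.+1 then if (a.+1 < s)%N then W a.+1 else V (a.+1 - s)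
  else if p n is V _ then V (t - s) else W 0.
  by rewrite /p; case: (u n) => //; case: n => // n; case: ifP.
have pS : p n.+1 = if u n.+1 is a.+1 then
    if (a.+1 < s)%N then W a.+1 else V (a.+1 - s)
  else if u n == t.-1 then V (t - s) else W 0 by [].
rewrite pS {1}pn {pS pn}; case: (u n) => [|a] ha; [case: (p n) => k|];
  case: (u n.+1) => [|b] //= hab.
- by lia.
- have -> : b = 0%N by lia.
  rewrite !ifT; try lia; exact: edge_hat2.
- by lia.
- have -> : b = 0%N by lia.
  rewrite !ifT; try lia; have := @edge_w s t 1; apply; lia.
- case: ltnP => h; first by lia.
  case: eqP => h'.
    have := @edge_v s t (t - s); rewrite (_ : (t - s).-1 = a.+1 - s)%N; last by lia.
    apply; lia.
  rewrite (_ : a.+1 - s = t - s)%N; last by lia.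
  exact: edge_hat1.
- have -> : b = a.+1 by lia.
  case: ltnP => h; case: ltnP => h'; try lia.
  + have := @edge_w s t a.+2; apply; lia.
  + have -> : a.+1 = (s - 1)%N by lia.
    have -> : ((s - 1).+1 - s = 0)%N by lia.
    exact: edge_hat3.
  + have := @edge_v s t (a.+2 - s).
    rewrite (_ : (a.+2 - s).-1 = a.+1 - s)%N; last by lia.
    apply; lia.
Qed.

(** * Joining two phases in a fixed time *)

Definition walk (t n a b : nat) : Prop :=
  exists g : nat -> nat,
    [/\ g 0%N = a, g n = b & forall k, (k < n)%N -> phase_step t (g k) (g k.+1)].

Lemma walk_trans t m n a b c :
  walk t m a b -> walk t n b c -> walk t (m + n) a c.
Proof.
move=> [g [ga gb gs]] [h [hb hc hs]].
exists (fun k => if (k < m)%N then g k else h (k - m)%N); split.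
- case: ifP => // m0; rewrite sub0n hb -gb -ga; congr (g _); lia.
- by rewrite ifF ?addKn//; lia.
- move=> k kn; have [km|km] := ltnP k m; last first.
    by rewrite ifF 1?subSn//; [apply: hs|]; lia.
  have [km'|km'] := ltnP k.+1 m; first exact: gs.
  have -> : (k.+1 = m)%N by lia.
  by rewrite subnn hb -gb (_ : m = k.+1) ?gs//; lia.
Qed.

Lemma walk_up t n a : (a + n <= t)%N -> walk t n a (a + n).
Proof.
move=> h; exists (fun k => a + k)%N; rewrite addn0; split=> // k kn.
by rewrite /phase_step; lia.
Qed.

Lemma walk_restart t a : (a == t.-1) || (a == t) -> walk t 1 a 0.
Proof.
move=> h; exists (fun k => if k is 0 then a else 0)%N; split=> // -[|k] //= _.
by rewrite /phase_step eqxx h orbT.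
Qed.

Lemma walk_loop t r : (0 < t)%N -> (r <= 1)%N -> walk t (t + r) 0 0.
Proof.
move=> t0 r1; have -> : (t + r = (t + r).-1 + 1)%N by lia.
apply: walk_trans; first by apply: walk_up; lia.
by apply: walk_restart; lia.
Qed.

(** Among the k loops, r have length t + 1 and the others length t. *)
Lemma walk_loops t k r : (0 < t)%N -> (r <= k)%N -> walk t (k * t + r) 0 0.
Proof.
move=> t0; elim: k r => [|k IH] r rk.
  have -> : r = 0%N by lia.
  by exists (fun=> 0%N).
have -> : (k.+1 * t + r = (t + (r == k.+1)) + (k * t + (r - (r == k.+1))))%N by lia.
by apply: walk_trans; [apply: walk_loop|apply: IH]; lia.
Qed.

Definition mixing_time (t : nat) : nat := (t * t + 2 * t + 1)%N.

(* Any two phases are joined by a walk of length exactly [mixing_time t], because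
   t and t + 1 are coprime and any number >= t^2 is a sum of t's and (t + 1)'s. *)
Lemma walk_mixing t a b : (0 < t)%N -> (a <= t)%N -> (b <= t)%N ->
  walk t (mixing_time t) a b.
Proof.
(* [D] is the time left for loops at 0 after the climb from a to t, one restart and the final climb
   to b. As D >= t^2, its quotient by t is at least t and exceeds the remainder. *)
move=> t0 at_ bt; rewrite /mixing_time; set D := (t * t + (t - b) + a)%N.
have -> : (t * t + 2 * t + 1 = (t - a) + (1 + (((D %/ t) * t + D %% t) + b)))%N.
  by rewrite -divn_eq /D; lia.
apply: (@walk_trans _ _ _ _ t).
  by rewrite -[X in walk _ _ _ X](subnKC at_); apply: walk_up; lia.
apply: (@walk_trans _ _ _ _ 0%N); first by apply: walk_restart; lia.
apply: (@walk_trans _ _ _ _ 0%N); last by rewrite -[X in walk _ _ _ X]add0n; exact: walk_up.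
apply: walk_loops => //; apply: (@leq_trans t); first by rewrite ltnW ?ltn_mod.
by rewrite leq_divRL// /D; lia.
Qed.

(** * Gluing clocks along a sequence, and counting *)

Definition cnt (P : nat -> bool) (N : nat) : nat := (\sum_(n < N) P n)%N.

Lemma cntS P N : cnt P N.+1 = (cnt P N + P N)%N.
Proof. by rewrite /cnt big_ord_recr. Qed.

(** For 1 < s < t, this says that the window of [w] of length M at n is a word of [F_st s t]. *)
Definition fits (s t M : nat) (w : nat -> bool) (n : nat) : Prop :=
  exists2 v, phases t v &
    forall k, (k < M)%N -> (v k < s)%N -> w (n + k)%N = false.

(** A walk of length [mixing_time t] leads from the imposed phase a to the clock of the window,
    which is followed from then on; only the walk can conflict with [w]. *)
Lemma fits_segment s t M w n a : (0 < t)%N -> (mixing_time t <= M)%N ->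
  (a <= t)%N -> fits s t M w n ->
  exists f : nat -> nat, [/\ f 0%N = a,
    forall k, (k < M)%N -> phase_step t (f k) (f k.+1) &
    forall k, (mixing_time t <= k < M)%N -> (f k < s)%N -> w (n + k)%N = false].
Proof.
move=> t0 CM at_ [v hv hw].
have [g [ga gb gs]] := walk_mixing t0 at_ (phases_le (mixing_time t) hv).
exists (fun k => if (k < mixing_time t)%N then g k else v k); split.
- by rewrite ifT// /mixing_time; lia.
- move=> k kM; case: ltnP => h1; case: ltnP => h2; [exact: gs| |lia|exact: hv.2].
  have E : mixing_time t = k.+1 by lia.
  by rewrite -E -gb E; apply: gs.
- by move=> k h; rewrite ifF; [apply: hw|]; lia.
Qed.

(* [w] is cut greedily into blocks of length [M] where it fits, separated by single
   positions where no such block starts. *)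
Lemma glue_phases s t M w : (0 < t)%N -> (mixing_time t <= M)%N ->
  exists2 u, phases t u & forall N,
    (M * cnt (fun n => (u n < s) && w n) N <=
     M * cnt (fun n => ~~ `[< fits s t M w n >]) N
     + mixing_time t * N + M * mixing_time t)%N.
Proof.
move=> t0 CM; set C := mixing_time t.
have C0 : (0 < C)%N by rewrite /C /mixing_time; lia.
have seg n a : exists f : nat -> nat, (a <= t)%N ->
  [/\ f 0%N = a,
    forall k, (k < M)%N -> phase_step t (f k) (f k.+1) &
    `[< fits s t M w n >] ->
    forall k, (C <= k < M)%N -> (f k < s)%N -> w (n + k)%N = false].
  have [at_|] := boolP (a <= t)%N; last by exists id.
  have [h|h] := pselect (fits s t M w n).
    have [f [f0 fs fw]] := fits_segment t0 CM at_ h.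
    by exists f.
  (* Where [w] does not fit, any clock started at a serves; this one has cycles of length t + 1. *)
  have [g gt gs] : exists2 g : nat -> nat, g 0%N = a &
      forall k, phase_step t (g k) (g k.+1).
    exists (fun k => iter k (fun b => if (b < t)%N then b.+1 else 0%N) a) => // k.
    have : (iter k (fun b => if (b < t)%N then b.+1 else 0%N) a <= t)%N.
      by elim: k => //= k; case: ifP => //; lia.
    by rewrite /= /phase_step; case: ifP; lia.
  by exists g => _; split=> // /asboolP.
have [F hF] := choice (fun na : nat * nat => seg na.1 na.2).
pose len n := if `[< fits s t M w n >] then M else 1%N.
(* In the state (m, a, k), the current block starts at time m in phase a, and the current time is m
   + k. *)
pose next (q : nat * nat * nat) := let: (m, a, k) := q in
  if (k.+1 < len m)%N then (m, a, k.+1) else ((m + k.+1)%N, F (m, a) k.+1, 0%N).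
pose st := fix st n := if n is n'.+1 then next (st n') else (0, 0, 0)%N.
pose u n := let: (m, a, k) := st n in F (m, a) k.
pose E N := cnt (fun n => (u n < s)%N && w n) N.
pose B N := cnt (fun n => ~~ `[< fits s t M w n >]) N.
have M1 : (1 <= M)%N by lia.
have lenM m : (1 <= len m <= M)%N by rewrite /len; case: ifP; lia.
(* A fitting block has at most C errors, of weight M * C, paid for when m advances by M; an error at
   a single position is paid for by [B]. The last term is the debt of the unfinished block. *)
have inv n : let: (m, a, k) := st n in
  [/\ (m + k = n)%N, (k < len m)%N, (a <= t)%N &
    (M * E n <= M * B n + C * m +
       M * (if `[< fits s t M w m >] then minn k C else 0))%N].
  elim: n => [|n].
    split=> //; first by have := lenM 0%N; lia.
    by rewrite /E /cnt big_ord0 muln0.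
  rewrite /= /E /B !cntS -/(E n) -/(B n) /u.
  case: (st n) => -[m a] k [mk kl at_ hE] /=.
  have [/= F0 Fs Fw] := hF (m, a) at_.
  have kM : (k < M)%N by have := lenM m; lia.
  move: kl; rewrite /len; case: ifP => fm kl; last first.
    have k0 : k = 0%N by lia.
    have -> : (k.+1 < 1)%N = false by lia.
    have mn : m = n by lia.
    rewrite fm in hE; rewrite -mn fm /= min0n.
    split; first by lia.
    - by have := lenM (m + k.+1)%N; rewrite /len; lia.
    - by have := Fs k kM; rewrite /phase_step; lia.
    - by rewrite -mn in hE; case: (_ && _); case: ifP => _; nia.
  have err : (M * ((F (m, a) k < s) && w n) <= M * (k < C))%N.
    rewrite leq_mul2l; apply/orP; right.
    have [kC|kC] := ltnP k C; first by case: (_ && _).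
    by case: ltnP => //= fs; rewrite -mk Fw// kC kM.
  rewrite fm in hE.
  have hE' : (M * (E n + ((F (m, a) k < s) && w n)) <=
     M * (B n + ~~ `[< fits s t M w n >]) + C * m + M * minn k.+1 C)%N.
    have : (minn k.+1 C = minn k C + (k < C))%N by lia.
    move=> ->; rewrite !mulnDr; lia.
  case: ifP => kl'.
    by split; rewrite ?fm//; lia.
  have kM' : k.+1 = M by lia.
  split.
  - lia.
  - by have := lenM (m + k.+1)%N; rewrite /len; lia.
  - by have := Fs k kM; rewrite /phase_step; lia.
  - rewrite min0n; apply: (leq_trans hE').
    have -> : minn k.+1 C = C by lia.
    rewrite kM' if_same muln0 addn0 -addnA leq_add2l mulnDr (mulnC M C); exact: leqnn.
exists u => [|N].
  split; first by have [//|/= f0 _ _] := hF (0, 0)%N; rewrite /u /= f0.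
  move=> n; rewrite /u /=; have := inv n; case: (st n) => -[m a] k [mk kl at_ _].
  have [/= F0 Fs Fw] := hF (m, a) at_.
  have kM : (k < M)%N by have := lenM m; lia.
  rewrite /next; case: ifP => kl'; first exact: Fs.
  have [|-> _ _] := hF ((m + k.+1)%N, F (m, a) k.+1).
    by have := Fs k kM; rewrite /phase_step /=; lia.
  exact: Fs.
have := inv N; case: (st N) => -[m a] k [mk kl at_ hE].
apply: (leq_trans hE); rewrite -/(B N); apply: leq_add.
  by rewrite leq_add2l leq_mul2l; lia.
by rewrite leq_mul2l; case: ifP; lia.
Qed.

Lemma cnt_le (P Q : nat -> bool) N :
  (forall n, (n < N)%N -> P n -> Q n) -> (cnt P N <= cnt Q N)%N.
Proof.
by move=> PQ; apply: leq_sum => i _; have := PQ i (ltn_ord i); case: (P i) => [->|].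
Qed.

Lemma cnt_le_id P N : (cnt P N <= N)%N.
Proof.
rewrite -[X in (_ <= X)%N](card_ord N) -sum1_card.
by apply: leq_sum => i _; case: (P i).
Qed.

Lemma cnt_or P Q N : (cnt (fun n => P n || Q n) N <= cnt P N + cnt Q N)%N.
Proof. by rewrite -big_split; apply: leq_sum => i _; case: (P i) (Q i) => -[]. Qed.

Lemma cnt_shift P k N : (cnt (fun n => P (n + k)%N) N <= cnt P (N + k))%N.
Proof.
elim: N => [|N IH]; first by rewrite /cnt big_ord0.
by rewrite addSn !cntS leq_add2r.
Qed.

Lemma cnt_exists (P : nat -> nat -> bool) K N :
  (cnt (fun n => `[< exists2 k, (k < K)%N & P k n >]) N
   <= \sum_(k < K) cnt (P k) N)%N.
Proof.
elim: K => [|K IH].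
  rewrite big_ord0 leqn0 /cnt big1// => i _.
  by case: asboolP => // -[].
rewrite big_ord_recr /=; apply: leq_trans (leq_add IH (leqnn _)).
apply: leq_trans (cnt_or _ _ _); apply: cnt_le => n _ /asboolP[k].
rewrite ltnS leq_eqVlt => /orP[/eqP->|kK Pk]; first by move=> ->; rewrite orbT.
by apply/orP; left; apply/asboolP; exists k.
Qed.

(** The shift by s makes the period start just after its zeros, so that no prefix has more than the
    share s / t of them, without additive error. *)
Lemma cnt_modn s t N : (0 < s <= t)%N ->
  (t * cnt (fun n => (n + s) %% t < s)%N N <= s * N)%N.
Proof.
move=> st.
have h : (cnt (fun n => (n + s) %% t < s)%N N + s =
    (N + s) %/ t * s + minn ((N + s) %% t) s)%N.
  elim: N => [|N IH].
    rewrite /cnt big_ord0 !add0n; have [<-|st'] := eqVneq s t.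
      by rewrite divnn modnn; lia.
    by rewrite divn_small ?modn_small; lia.
  rewrite cntS addnAC IH addSn.
  have := ltn_pmod (N + s) (_ : 0 < t)%N.
  have D := divn_eq (N + s) t; set q := (_ %/ t)%N in D *; set r := (_ %% t)%N in D *.
  move=> /(_ ltac:(lia)) rt.
  have [r1|r1] := ltnP r.+1 t.
    rewrite D -addnS divnMDl; last by lia.
    by rewrite modnMDl divn_small// modn_small//; case: ltnP; lia.
  have -> : ((N + s).+1 = q.+1 * t + 0)%N by lia.
  by rewrite divnMDl ?modnMDl ?div0n ?mod0n; [case: ltnP; lia|lia].
have D := divn_eq (N + s) t; set q := (_ %/ t)%N in D h *; set r := (_ %% t)%N in D h *.
have rt : (r < t)%N by rewrite ltn_mod; lia.
suff : (t * (cnt (fun n => (n + s) %% t < s)%N N + s) <= s * N + s * t)%N.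
  by rewrite mulnDr (mulnC s t) leq_add2r.
have D' : (s * N + s * s = s * (q * t) + s * r)%N by rewrite -!mulnDr D.
rewrite h; have [rs|rs] := leqP r s.
  have [d td] : exists d, t = (s + d)%N by exists (t - s)%N; lia.
  have [e se] : exists e, s = (r + e)%N by exists (s - r)%N; lia.
  have : (t * r + s * s <= s * r + s * t)%N by rewrite td se; lia.
  by move: D'; clear; lia.
have : (s * s <= s * r)%N by rewrite leq_mul2l ltnW ?orbT.
by move: D'; clear; lia.
Qed.

(** * Periodic clocks and the density of their zeros *)

(** These are the forced zeros of the clock of period 10^i started in phase 2^i, that is, just after
    its zeros. *)
Definition sparse (i n : nat) : bool := ((n + 2 ^ i) %% 10 ^ i < 2 ^ i)%N.

Lemma params_lt i : (1 <= i)%N -> (1 < 2 ^ i < 10 ^ i)%N.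
Proof.
move=> i1; apply/andP; split; last by rewrite ltn_exp2r.
by have := ltn_expl i (ltnSn 1); lia.
Qed.

Lemma cnt_sparse i N : (5 ^ i * cnt (sparse i) N <= N)%N.
Proof.
rewrite -(@leq_pmul2l (2 ^ i)) ?expn_gt0// mulnA -expnMn.
rewrite (_ : 2 * 5 = 10)%N//; apply: cnt_modn; rewrite expn_gt0 /=.
by case: i => // i; rewrite leq_exp2r.
Qed.

(** The densities 5^(-i), i > i0, add up to 5^(-i0) / 4. Below N the union is finite, since
    [sparse i n] with i >= 1 forces i <= n. *)
Lemma cnt_sparse_tail i0 N :
  (4 * 5 ^ i0 * cnt (fun n => `[< exists2 i, (i0 < i)%N & sparse i n >]) N <= N)%N.
Proof.
have tail J : (4 * 5 ^ (i0 + J) * \sum_(k < J) cnt (sparse (i0 + k.+1)) N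
    <= N * (5 ^ J).-1)%N.
  elim: J => [|J IH]; first by rewrite big_ord0 muln0.
  rewrite big_ord_recr /=; have := cnt_sparse (i0 + J.+1) N.
  move: (cnt _ _) (\sum_(_ < _) _)%N IH => c S.
  rewrite addnS !expnS; have : (0 < 5 ^ J)%N by rewrite expn_gt0.
  move: (5 ^ J)%N (5 ^ (i0 + J))%N => x y; nia.
have sp i n : (1 <= i)%N -> sparse i n -> (i <= n)%N.
  move=> i1; rewrite /sparse; have [h|h _] := ltnP (n + 2 ^ i) (10 ^ i).
    by rewrite modn_small//; lia.
  have : (i < 2 ^ i)%N by rewrite ltn_expl.
  suff : (2 * 2 ^ i <= 10 ^ i)%N by lia.
  have -> : (10 ^ i = 5 ^ i * 2 ^ i)%N by rewrite -expnMn.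
  by rewrite leq_mul2r; apply/orP; right; apply: leq_trans (leq_pexp2l _ i1).
have le : (cnt (fun n => `[< exists2 i, (i0 < i)%N & sparse i n >]) N
    <= \sum_(k < N) cnt (sparse (i0 + k.+1)) N)%N.
  apply: leq_trans (cnt_exists (fun k => sparse (i0 + k.+1)) N N).
  apply: cnt_le => n nN /asboolP[i ii si]; apply/asboolP.
  by exists (i - i0).-1; [have := sp i n|rewrite (_ : i0 + _ = i)%N]; lia.
rewrite -(@leq_pmul2r (5 ^ N)) ?expn_gt0//.
apply: leq_trans (_ : N * (5 ^ N).-1 <= _)%N; last by rewrite leq_mul2l leq_pred orbT.
apply: leq_trans (tail N).
by rewrite expnD mulnA mulnAC leq_mul2l le orbT.
Qed.

(** * [YY] as a shift space: invariance, a point rich in ones, closedness *)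

Lemma YYP x : YY x <-> forall i, (1 <= i)%N ->
  exists2 u, phases (10 ^ i) u & forall n, (u n < 2 ^ i)%N -> x n = false.
Proof.
by split=> h i i1; have /(F_stP _ (params_lt i1)) := h i i1.
Qed.

Lemma YY_shift w : YY w -> YY (left_shift w).
Proof.
move=> /YYP h; apply/YYP => i /h[u hu hw].
exists (fun n => u (n + 1)%N); first exact: phases_shift.
by move=> n; rewrite /left_shift addn1; exact: hw.
Qed.

Lemma iter_shiftE n w k : iter n left_shift w k = w (k + n)%N.
Proof.
by elim: n k => [|n IH] k; rewrite ?addn0//= /left_shift IH addSnnS.
Qed.

Lemma YY_iter n w : YY w -> YY (iter n left_shift w).
Proof. by move=> h; elim: n => //= n; exact: YY_shift. Qed.

(** All periodic clocks are imposed at once; every prefix keeps at least three quarters of ones. *)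
Definition max_point : cantor_space := fun n => ~~ `[< exists2 i, (0 < i)%N & sparse i n >].

Lemma YY_max_point : YY max_point.
Proof.
apply/YYP => i i1; exists (fun n => (n + 2 ^ i) %% 10 ^ i)%N.
  by apply: phases_modn; have := params_lt i1; lia.
by move=> n h; apply/negbF/asboolP; exists i.
Qed.

(** If each a <= t failed at some stage, all of them would fail at the largest of these finitely
    many stages. *)
Lemma bounded_pigeonhole t (Q : nat -> nat -> Prop) :
  (forall N, exists2 a, (a <= t)%N & Q a N) ->
  (forall a N N', (N <= N')%N -> Q a N' -> Q a N) ->
  exists2 a, (a <= t)%N & forall N, Q a N.
Proof.
move=> hQ mono; apply: contrapT => no.
have bad a : exists N, (a <= t)%N -> ~ Q a N.
  have [at_|] := boolP (a <= t)%N; last by exists 0%N.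
  have /existsNP[N hN] : ~ forall N, Q a N by move=> h; apply: no; exists a.
  by exists N.
have [f hf] := choice bad.
have [a at_ ha] := hQ (\max_(b < t.+1) f b)%N.
apply: (hf a at_); apply: mono ha.
exact: (leq_bigmax (Ordinal (at_ : (a < t.+1)%N))).
Qed.

(* König's lemma on the tree of phase sequences compatible with prefixes of [x]. *)
Lemma phases_compact s t (x : nat -> bool) :
  (forall N, exists2 u, phases t u &
     forall n, (n < N)%N -> (u n < s)%N -> x n = false) ->
  exists2 u, phases t u & forall n, (u n < s)%N -> x n = false.
Proof.
move=> hx.
pose fit n a N u := [/\ phases t u, u 0%N = a &
  forall k, (k < N)%N -> (u k < s)%N -> x (n + k)%N = false].
have fit_mono n a N N' u : (N <= N')%N -> fit n a N' u -> fit n a N u.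
  by move=> NN' [hu ua hk]; split=> // k kN; apply: hk; lia.
pose ext n a := forall N, exists u, fit n a N u.
have [a0 a0t ha0] : exists2 a, (a <= t)%N & ext 0%N a.
  apply: bounded_pigeonhole => [N|a N N' NN' [u hu]]; last first.
    by exists u; exact: fit_mono hu.
  by have [u hu hk] := hx N; exists (u 0%N); [exact: phases_le|exists u].
have next na : exists b, ext na.1 na.2 -> phase_step t na.2 b /\ ext na.1.+1 b.
  case: na => n a /=; have [e|] := pselect (ext n a); last by exists 0%N.
  have [b bt hb] : exists2 b, (b <= t)%N & forall N,
      exists u, fit n a N.+1 u /\ u 1%N = b.
    apply: bounded_pigeonhole => [N|b N N' NN' [u [hu ub]]]; last first.
      by exists u; split=> //; exact: fit_mono hu.
    by have [u hu] := e N.+1; exists (u 1%N); [case: hu => *; exact: phases_le|exists u].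
  exists b => _; split=> [|N].
    by have [u [[hu <- _] <-]] := hb 0%N; exact: hu.2.
  have [u [[hu _ hk] ub]] := hb N; exists (fun n => u (n + 1)%N); split=> //.
    exact: phases_shift.
  by move=> k kN us; rewrite addSnnS -addn1 hk//; lia.
have [f hf] := choice next.
pose u := fix u n := if n is m.+1 then f (m, u m) else a0.
have eu n : ext n (u n).
  by elim: n => // n IH; have [] := hf (n, u n) IH.
exists u; first by split=> // n; have [] := hf (n, u n) (eu n).
by move=> n; have [v [_ <- h]] := eu n 1%N; move/(h 0%N); rewrite addn0; apply.
Qed.

Definition agree (L : nat) (x y : nat -> bool) : Prop :=
  forall k, (k < L)%N -> x k = y k.

Lemma agreeW L L' x y : (L <= L')%N -> agree L' x y -> agree L x y.
Proof. by move=> LL h k kL; apply: h; exact: leq_trans LL. Qed.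

Lemma agree_sym L x y : agree L x y -> agree L y x.
Proof. by move=> h k kL; rewrite h. Qed.

Lemma agree_trans L x y z : agree L x y -> agree L y z -> agree L x z.
Proof. by move=> h h' k kL; rewrite h// h'. Qed.

Lemma nbhs_agree (x : cantor_space) L : nbhs x [set y | agree L x y].
Proof.
elim: L => [|L IH]; first by apply: filterS filterT => y _ k.
have : nbhs x (fun y : cantor_space => y L = x L).
  have h := @proj_continuous nat (fun=> bool) L x [set x L].
  exact: (h (discrete_set1 _)).
move=> h; near=> y => k; rewrite ltnS leq_eqVlt => /orP[/eqP->|].
  by apply/esym; near: y.
by move: k; near: y.
Unshelve. all: by end_near. Qed.

(** Otherwise points outside U sharing ever longer prefixes with x would converge to x
    coordinatewise. *)
Lemma nbhs_agree_sub (x : cantor_space) (U : set cantor_space) :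
  nbhs x U -> exists L, forall y, agree L x y -> U y.
Proof.
move=> xU; apply: contrapT => /forallNP no.
have bad L : exists y, agree L x y /\ ~ U y.
  by have /existsNP[y /not_implyP[]] := no L; exists y.
have [f hf] := choice bad.
have : (f : nat -> cantor_space) @ \oo --> x.
  apply/cvg_sup => N V [W] [[B] oB <-] WfN WV.
  apply: (filterS WV); rewrite nbhs_simpl /=; exists N.+1 => // i /= iN.
  by rewrite -((hf i).1 N iN).
by move=> /(_ U xU) [N _ /(_ N (leqnn N))]; exact: (hf N).2.
Qed.

Lemma closed_YY : closed YY.
Proof.
move=> x hx; apply/YYP => i i1; apply: phases_compact => N.
have [y [/YYP/(_ i i1)[u hu hy] xy]] := hx _ (nbhs_agree x N).
by exists u => // n nN un; rewrite xy// hy.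
Qed.

Lemma compact_YY : compact YY.
Proof. exact: subclosed_compact closed_YY cantor_space_compact _. Qed.

Lemma shift_space_YY : shift_space YY.
Proof.
split; [|exact: closed_YY|exact: YY_shift].
by exists max_point; exact: YY_max_point.
Qed.

(** * Forced runs of zeros against the density of ones *)

(** A clock that avoids 0 climbs at each step and would exceed t after t + 1 steps; from 0 it runs
    through all phases below 2^i. *)
Lemma zero_run (z : cantor_space) i : (1 <= i)%N -> YY z ->
  exists2 p, (p <= (10 ^ i).+1)%N & forall k, (k < 2 ^ i)%N -> z (p + k)%N = false.
Proof.
move=> i1 /YYP/(_ i i1)[u hu hz]; have lt := params_lt i1.
set s := (2 ^ i)%N in hz lt *; set t := (10 ^ i)%N in hu lt *.
have [p pt up] : exists2 p, (p <= t.+1)%N & u p = 0%N.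
  apply: contrapT => no.
  have up k : (k <= t.+1)%N -> (k <= u k)%N.
    elim: k => // k IH kt; have := hu.2 k; have := IH (ltnW kt).
    have : u k.+1 <> 0%N by move=> h; apply: no; exists k.+1.
    by rewrite /phase_step; lia.
  by have := up t.+1 (leqnn _); have := phases_le t.+1 hu; lia.
exists p => // k ks; apply: hz; suff -> : u (p + k)%N = k by [].
elim: k ks => [|k IH] ks; first by rewrite addn0.
have := hu.2 (p + k)%N; rewrite addnS IH; last by lia.
by rewrite /phase_step; lia.
Qed.

Lemma cnt_max_point N : (4 * cnt (fun n => ~~ max_point n) N <= N)%N.
Proof.
have := cnt_sparse_tail 0 N; rewrite muln1; apply: leq_trans.
by rewrite leq_mul2l; apply/orP; right; apply: cnt_le => n _; rewrite negbK.
Qed.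

Lemma card_cnt (P : nat -> bool) N : #|[pred j : 'I_N | P j]| = cnt P N.
Proof.
rewrite -sum1_card /cnt big_mkcond; apply: eq_bigr => i _.
by rewrite inE; case: (P i).
Qed.

(** * Compatible metrics compared with common prefixes; failure of almost specification *)

Section Metric.
Variables (R : realType) (rho : cantor_space -> cantor_space -> R).
Hypotheses (mrho : metric_on YY rho) (crho : compatible_on YY rho).

Lemma rho_ball x (e : R) : YY x -> 0 < e ->
  exists L, forall y, YY y -> agree L x y -> rho x y < e.
Proof.
move=> Yx e0.
have : within YY (nbhs x) [set y | rho x y < e].
  by apply/(crho Yx); exists e.
move=> /nbhs_agree_sub[L hL]; exists L => y Yy xy; exact: hL.
Qed.

Lemma rho_near x (e : R) : YY x -> 0 < e ->
  \forall y \near x, YY y -> rho x y < e.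
Proof.
move=> Yx e0; have [L hL] := rho_ball Yx e0.
by apply: filterS (nbhs_agree x L) => y xy Yy; exact: hL.
Qed.

(** By compactness: half of a radius that forces agreement with x works at all points near x. *)
Lemma uniform_agree L : exists2 c : R, 0 < c &
  forall x y, YY x -> YY y -> rho x y < c -> agree L x y.
Proof.
have [_ _ sym tri] := mrho.
have /compact_near_coveringP/near_covering_withinP cov := compact_YY.
pose P (c : R) (x : cantor_space) := forall y, YY y -> rho x y < c -> agree L x y.
have : \forall c \near 0^'+, YY `<=` P c.
  apply: (cov _ _ P) => x Yx.
  have /(crho Yx)[e e0 he] : within YY (nbhs x) [set y | agree L x y].
    by apply: filterS (nbhs_agree x L).
  near=> x' c.
  have xx' : YY x' -> rho x x' < e / 2.
    by near: x'; apply: rho_near => //; rewrite divr_gt0.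
  move=> /= Yx' y Yy yc; move/(_ Yx') in xx'.
  have ce : c < e / 2 by near: c; apply: nbhs_right_lt; rewrite divr_gt0.
  apply: (@agree_trans _ _ x); last first.
    apply: he => //; apply: le_lt_trans (tri _ _ _ Yx Yx' Yy) _.
    lra.
  by apply/agree_sym/he => //; lra.
move=> near0; near (0 : R)^'+ => c; exists c; first by near: c; exact: nbhs_right_gt.
by move=> x y Yx; apply: (near near0 c _ x Yx).
Unshelve. all: by end_near. Qed.

Lemma uniform_rho (e : R) : 0 < e -> exists L,
  forall x y, YY x -> YY y -> agree L x y -> rho x y < e.
Proof.
move=> e0; have [_ _ sym tri] := mrho.
have /compact_near_coveringP/near_covering_withinP cov := compact_YY.
pose P L (x : cantor_space) := forall y, YY y -> agree L x y -> rho x y < e.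
have : \forall L \near \oo, YY `<=` P L.
  apply: (cov _ _ P) => x Yx.
  have e20 : 0 < e / 2 by rewrite divr_gt0.
  have [L hL] := rho_ball Yx e20.
  near=> x' L' => /= Yx' y Yy yc.
  have LL' : (L <= L')%N by near: L'; exact: nbhs_infty_ge.
  have xx' : agree L x x' by near: x'; exact: nbhs_agree.
  apply: le_lt_trans (tri _ _ _ Yx' Yx Yy) _.
  have := hL _ Yx' xx'; have := hL _ Yy (agree_trans xx' (agreeW LL' yc)).
  by rewrite (sym x' x)//; lra.
by case=> L _ /(_ L (leqnn L)) h; exists L => x y Yx; exact: h.
Unshelve. all: by end_near. Qed.

Lemma bounded_rho : exists D : R, forall x y, YY x -> YY y -> rho x y <= D.
Proof.
have [_ _ sym tri] := mrho.
have /compact_near_coveringP/near_covering_withinP cov := compact_YY.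
pose P n (x : cantor_space) := rho max_point x <= n%:R.
have Y0 := YY_max_point.
have : \forall n \near \oo, YY `<=` P n.
  apply: (cov _ _ P) => x Yx.
  near=> x' n.
  have xx' : YY x' -> rho x x' < 1 by near: x'; exact: rho_near.
  move=> /= Yx'; move/(_ Yx') in xx'.
  have : rho max_point x + 1 <= n%:R by near: n; exact: nbhs_infty_ger.
  by have := tri _ _ _ Y0 Yx Yx'; rewrite /P; lra.
case=> n _ /(_ n (leqnn n)) h; exists (n%:R + n%:R) => x y Yx Yy.
apply: le_trans (tri _ _ _ Yx Y0 Yy) _.
by rewrite (sym x)//; apply: lerD; exact: h.
Unshelve. all: by end_near. Qed.

(* In a concatenation of copies of a prefix of [max_point] of length 2^i, the forced
   run of 2^(i+1) zeros covers a whole copy. *)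
Lemma not_almost_specification : ~ almost_specification YY left_shift rho.
Proof.
case=> e0 [g [[e00 hg] spec]].
(* Points at distance below c have the same first symbol, so a copy coincides with [max_point]
   outside its mistakes. *)
have [c c0 hc] := uniform_agree 1.
pose e := Num.min c (e0 / 2).
have ee : 0 < e < e0.
  rewrite /e; apply/andP; split; first by rewrite lt_min c0 /=; lra.
  by rewrite gt_min; apply/orP; right; lra.
have ec : e <= c by rewrite /e ge_min lexx.
have [_ /cvgrPdist_lt/(_ (2^-1))] := hg e ee.
rewrite invr_gt0 => /(_ ltac:(by [])) [n0 _ hn0].
pose i := (k_mistake g e + n0)%N; pose n := (2 ^ i)%N.
have ni : (i < n)%N by rewrite /n ltn_expl.
have nk : (k_mistake g e <= n)%N by lia.
have gn : (2 * g n e < n)%N.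
  have := hn0 n _; rewrite /= => /(_ ltac:(lia)); rewrite sub0r normrN ger0_norm; last first.
    by rewrite divr_ge0.
  rewrite ltr_pdivrMr; last by rewrite ltr0n; lia.
  by move=> h; rewrite -(ltr_nat R) natrM; lra.
(* The forced run of 2 * n zeros starts at some p <= 10^(i+1) + 1, so the first copy starting at or
   after p has an index j < m; it ends within the run. *)
pose m := (10 ^ i.+1 + 3)%N.
have [] := spec m (fun=> e) (fun=> max_point) (fun=> n); [by rewrite /m; lia|by []|
  by move=> _; exact: YY_max_point|by []|].
move=> z Yz hz.
have [p pm hp] := zero_run (ltn0Sn i) Yz.
pose j := ((p + n.-1) %/ n)%N.
have jn : (p <= j * n < p + n)%N.
  have := divn_eq (p + n.-1)%N n; have := ltn_pmod (p + n.-1)%N (_ : 0 < n)%N.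
  by rewrite -/j => /(_ ltac:(lia)); lia.
have jm : (j < m)%N.
  rewrite ltn_divLR; last by lia.
  by rewrite /m; nia.
have [_] := hz (Ordinal jm).
have -> : (\sum_(k < m | (k < Ordinal jm)%N) n = j * n)%N.
  by rewrite -(big_ord_widen m (fun=> n) (ltnW jm)) sum_nat_const card_ord.
apply/negP; rewrite -ltnNge.
(* Copy j is zero, so it agrees with [max_point] only at zeros of the latter: at most n / 4
   positions, while more than n / 2 are required. *)
apply: (@leq_ltn_trans (cnt (fun n => ~~ max_point n) n)); last first.
  by have := cnt_max_point n; lia.
rewrite -card_cnt; apply: subset_leq_card; apply/fintype.subsetP => k.
rewrite !inE -iterD => h.
have := hc _ _ (YY_iter k YY_max_point) (YY_iter (k + j * n)%N Yz)
  (lt_le_trans h ec) 0%N (ltnSn 0).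
rewrite !iter_shiftE !add0n => ->.
rewrite (_ : k + j * n = p + (k + j * n - p))%N; last by lia.
rewrite hp// expnS -/n; have := ltn_ord k; lia.
Qed.
End Metric.

(** * Upper density and approximation by points of [YY] *)

(** A bound for every N with an additive constant, instead of a limsup, passes directly to shifts
    and finite unions. *)
Definition upper_density_le (R : realType) (P : nat -> Prop) (r : R) : Prop :=
  exists K : R, forall N, (cnt (fun n => `[< P n >]) N)%:R <= r * N%:R + K.

Section Density.
Variable R : realType.
Implicit Types (P Q : nat -> Prop) (r : R).

Lemma density_sub P Q r :
  (forall n, P n -> Q n) -> upper_density_le Q r -> upper_density_le P r.
Proof.
move=> PQ [K hK]; exists K => N; apply: le_trans (hK N).
by rewrite ler_nat; apply: cnt_le => n _ /asboolP/PQ/asboolP.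
Qed.

Lemma density_or P Q r1 r2 : upper_density_le P r1 -> upper_density_le Q r2 ->
  upper_density_le (fun n => P n \/ Q n) (r1 + r2).
Proof.
move=> [K hK] [K' hK']; exists (K + K') => N.
apply: le_trans (_ : (cnt (fun n => `[< P n >]) N + cnt (fun n => `[< Q n >]) N)%:R <= _).
  rewrite ler_nat; apply: leq_trans (cnt_or _ _ _); apply: cnt_le => n _.
  by rewrite asbool_or.
by rewrite natrD; have := hK N; have := hK' N; lra.
Qed.

Lemma density_shift P r k :
  upper_density_le P r -> upper_density_le (fun n => P (n + k)%N) r.
Proof.
move=> [K hK]; exists (r * k%:R + K) => N.
apply: le_trans (_ : (cnt (fun n => `[< P n >]) (N + k))%:R <= _).
  by rewrite ler_nat; exact: (cnt_shift (fun n => `[< P n >])).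
by apply: le_trans (hK _) _; rewrite natrD; lra.
Qed.

Lemma density_exists (P : nat -> nat -> Prop) r L :
  (forall k, (k < L)%N -> upper_density_le (P k) r) ->
  upper_density_le (fun n => exists2 k, (k < L)%N & P k n) (L%:R * r).
Proof.
elim: L => [|L IH] h.
  exists 0 => N; rewrite !mul0r addr0 /cnt big1// => i _.
  by case: asboolP => // -[].
rewrite -natr1 mulrDl mul1r.
have hL : upper_density_le (fun n => exists2 k, (k < L)%N & P k n) (L%:R * r).
  by apply: IH => k kL; apply: h; exact: ltnW.
apply: density_sub (density_or hL (h L (ltnSn L))) => n [k].
by rewrite ltnS leq_eqVlt => /orP[/eqP->|kL Pk]; [right|left; exists k].
Qed.

(** Each i <= i0 costs r for the windows that are not words of [YY] and C / M for joining clocks;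
    all i > i0 together cost at most 5^(-i0). Erasing ones for one clock never violates another. *)
Lemma YY_approx (w : nat -> bool) M i0 r :
  (mixing_time (10 ^ i0) <= M)%N ->
  upper_density_le (fun n => ~ exists2 y, YY y & agree M y (fun k => w (n + k)%N)) r ->
  exists2 z, YY z & upper_density_le (fun n => z n <> w n)
    (i0%:R * (r + (mixing_time (10 ^ i0))%:R / M%:R) + (5 ^ i0)%:R^-1).
Proof.
move=> CM hr; set C := mixing_time _ in CM *.
have M0 : (0 < M)%N by move: CM; rewrite /C /mixing_time; lia.
have MR : 0 < M%:R :> R by rewrite ltr0n.
have hu i : exists u, (0 < i)%N -> [/\ phases (10 ^ i) u,
    (i <= i0)%N -> upper_density_le (fun n => (u n < 2 ^ i)%N && w n) (r + C%:R / M%:R) &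
    (i0 < i)%N -> forall n, (u n < 2 ^ i)%N = sparse i n].
  have [ii0|ii0] := leqP i i0; last first.
    exists (fun n => (n + 2 ^ i) %% 10 ^ i)%N => i1; split=> //.
    by apply: phases_modn; have := params_lt i1; lia.
  have Ci : (mixing_time (10 ^ i) <= C)%N.
    have : (10 ^ i <= 10 ^ i0)%N by rewrite leq_exp2l.
    by rewrite /C /mixing_time; nia.
  clearbody C.
  have [u hu hc] := @glue_phases (2 ^ i) (10 ^ i) M w
    (ltac:(by rewrite expn_gt0)) (leq_trans Ci CM).
  exists u => i1; split=> // _.
  have [K hK] : upper_density_le (fun n => ~ fits (2 ^ i) (10 ^ i) M w n) r.
    apply: density_sub hr => n nfit [y /YYP/(_ i i1)[v hv hy] yw]; apply: nfit.
    by exists v => // k kM vk; rewrite -yw// hy.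
  exists (K + C%:R) => N; rewrite -(ler_pM2l MR).
  have -> : cnt (fun n => `[< (u n < 2 ^ i)%N && w n >]) N =
      cnt (fun n => (u n < 2 ^ i)%N && w n) N.
    by apply: eq_bigr => n _; rewrite asboolb.
  have -> : M%:R * ((r + C%:R / M%:R) * N%:R + (K + C%:R)) =
     M%:R * (r * N%:R + K) + C%:R * N%:R + M%:R * C%:R.
    by field; rewrite lt0r_neq0.
  apply: le_trans (_ : (M * cnt (fun n => ~~ `[< fits (2 ^ i) (10 ^ i) M w n >]) N
    + C * N + M * C)%N%:R <= _).
    rewrite -natrM ler_nat; apply: leq_trans (hc N) _.
    by apply: leq_add; rewrite ?leq_add2l leq_mul.
  rewrite !natrD !natrM !lerD2r ler_pM2l//; apply: le_trans (hK N).
  by rewrite ler_nat; apply: cnt_le => n _; rewrite asbool_neg.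
have [u {}hu] := choice hu.
pose z : cantor_space := fun n => w n && ~~ `[< exists2 i, (0 < i)%N & (u i n < 2 ^ i)%N >].
exists z.
  apply/YYP => i i1; have [ph _ _] := hu i i1; exists (u i) => // n un.
  by apply/negbTE; rewrite negb_and negbK; apply/orP; right; apply/asboolP; exists i.
have near_part := density_exists (P := fun k n => (u k.+1 n < 2 ^ k.+1)%N && w n)
  (fun k (kL : (k < i0)%N) => (let: And3 _ h _ := hu k.+1 (ltn0Sn k) in h) kL).
have far_part : upper_density_le (fun n => exists2 i, (i0 < i)%N & sparse i n)
    ((5 ^ i0)%:R^-1 : R).
  exists 0 => N; rewrite addr0 mulrC ler_pdivlMr ?ltr0n ?expn_gt0// -natrM ler_nat.
  by have := cnt_sparse_tail i0 N; move: (cnt _ _) (5 ^ i0)%N => a b; nia.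
apply: density_sub (density_or near_part far_part) => n.
rewrite /z; case wn : (w n) => //=; case: asboolP => // -[i i1 ui] _.
have [ii0|ii0] := leqP i i0.
  by left; exists i.-1; rewrite prednK// ui.
by right; exists i => //; have [_ _ <-] := hu i i1.
Qed.

End Density.

(** * Average shadowing *)

Lemma limn_esup_le (R : realType) (u : nat -> \bar R) (a : \bar R) N0 :
  (forall N, (N0 <= N)%N -> (u N <= a)%E) -> (limn_esup u <= a)%E.
Proof.
move=> h; apply: le_trans (_ : ereal_sup (u @` [set N | (N0 <= N)%N]) <= a)%E.
  apply: ereal_inf_lbound; exists [set N | (N0 <= N)%N] => //.
  exact: nbhs_infty_ge.
by apply: ge_ereal_sup => _ [N hN <-]; exact: h.
Qed.

Lemma natr_gt (R : realType) (x : R) : exists n : nat, x < n%:R.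
Proof. by exists (Num.trunc x).+1; exact: truncnS_gt. Qed.

Section Shadowing.
Variables (R : realType) (rho : cantor_space -> cantor_space -> R).
Hypotheses (mrho : metric_on YY rho) (crho : compatible_on YY rho).

(** Markov's inequality: each jump adds at least c to a sum that is below delta * N once N > N0; the
    constant N0 covers smaller N. *)
Lemma density_jump (x : nat -> cantor_space) (delta c : R) L :
  0 < delta -> 0 < c ->
  (forall x y, YY x -> YY y -> rho x y < c -> agree L x y) ->
  average_pseudoorbit YY left_shift rho delta x ->
  upper_density_le (fun n => ~ agree L (left_shift (x n)) (x n.+1)) (delta / c).
Proof.
move=> d0 c0 hc [xY [N0 [N00 hN0]]]; exists N0%:R => N.
have [rho0 _ _ _] := mrho.
have dc0 : 0 <= delta / c * N%:R by rewrite mulr_ge0// divr_ge0// ltW.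
have [NN0|NN0] := leqP N N0.
  apply: le_trans (_ : N0%:R <= _); last by rewrite lerDr.
  by rewrite ler_nat; apply: leq_trans NN0; exact: cnt_le_id.
apply: le_trans (_ : delta / c * N%:R <= _); last by rewrite lerDl.
rewrite mulrAC ler_pdivlMr//.
have N0R : 0 < N%:R :> R by rewrite ltr0n; lia.
have := hN0 N 0%N NN0; rewrite mulrC ltr_pdivrMr// => /ltW; apply: le_trans.
rewrite /cnt natr_sum mulr_suml; apply: ler_sum => n _; rewrite addn0 addn1.
have Yx : YY (left_shift (x n)) by exact: YY_shift.
case: asboolP => /= h; last by rewrite mul0r rho0.
by rewrite mul1r leNgt; apply/negP => /(hc _ _ Yx (xY _)).
Qed.

(** Symbol k of x n passes to x (n + 1), x (n + 2), ..., its index dropping by one each time, until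
    it is the first symbol of x (n + k). *)
Lemma agree_pseudoorbit (x : nat -> cantor_space) L n :
  (forall j, (j < L)%N -> agree L (left_shift (x (n + j)%N)) (x (n + j).+1)) ->
  agree L (x n) (fun k => x (n + k)%N 0%N).
Proof.
move=> h k kL; suff : forall j, (j <= k)%N -> x n k = x (n + j)%N (k - j)%N.
  by move=> /(_ k (leqnn k)); rewrite subnn.
elim=> [|j IH] jk; first by rewrite addn0 subn0.
rewrite IH; last exact: ltnW.
have -> : (k - j = (k - j.+1).+1)%N by lia.
by rewrite addnS -(h j _ (k - j.+1)%N)//; lia.
Qed.

Lemma average_shadowing_YY : average_shadowing YY left_shift rho.
Proof.
move=> eps eps0.
have e4 : 0 < eps / 4 by rewrite divr_gt0.
have [L hL] := uniform_rho mrho crho e4.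
have [D0 hD0] := bounded_rho mrho crho.
pose D := `|D0| + 1.
have D0' : 0 < D by rewrite ltr_wpDl.
have hD x y : YY x -> YY y -> rho x y <= D.
  move=> Yx Yy; apply: le_trans (hD0 _ _ Yx Yy) _.
  by apply: le_trans (ler_norm D0) _; rewrite lerDl.
(* Bad times will have density at most 3 * th, hence cost at most 3 * th * D = eps / 4 on
   average. *)
pose th := eps / (12 * D).
have th0 : 0 < th by rewrite divr_gt0// mulr_gt0.
have [i0 hi0] := natr_gt (L%:R / th).
pose C := mixing_time (10 ^ i0).
have [M0 hM0] := natr_gt (L%:R * i0%:R * C%:R / th).
have [M [CM LM M0M M1]] : exists M, [/\ C <= M, L <= M, M0 <= M & 0 < M]%N.
  by exists (M0 + C + L + 1)%N; clearbody C; split; lia.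
have MR : 0 < M%:R :> R by rewrite ltr0n.
have [c c0 hc] := uniform_agree mrho crho M.
(* [b] bounds the density of jumps. A window of length M meets one with density at most M * b, which
   is counted once for x against [w] and L * i0 times for z against [w]. *)
pose b := th / (M%:R * (1 + L%:R * i0%:R)).
have W0 : 0 < 1 + L%:R * i0%:R :> R by rewrite ltr_pwDl// mulr_ge0.
have b0 : 0 < b by rewrite divr_gt0// mulr_gt0.
exists (c * b) => [|x hx]; first exact: mulr_gt0.
have cb0 : 0 < c * b by rewrite mulr_gt0.
have xY := hx.1.
have := density_jump cb0 c0 hc hx; rewrite mulrC mulKf ?lt0r_neq0// => jump.
pose w n := x n 0%N.
have bad : upper_density_le (fun n => ~ agree M (x n) (fun k => w (n + k)%N)) (M%:R * b).
  have := density_exists (fun j (_ : (j < M)%N) => density_shift j jump).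
  apply: density_sub => n nag; apply: contrapT => /forall2NP h; apply: nag.
  apply: agree_pseudoorbit => j jM; apply: contrapT => nj.
  by case: (h j).
have bad_words : upper_density_le
    (fun n => ~ exists2 y, YY y & agree M y (fun k => w (n + k)%N)) (M%:R * b).
  by apply: density_sub bad => n nex ag; apply: nex; exists (x n).
have [z Yz hz] := YY_approx CM bad_words.
exists z => //.
have [K hK] : upper_density_le (fun n => ~ agree L (iter n left_shift z) (x n)) (3 * th).
  have := density_or bad (density_exists (fun j (_ : (j < L)%N) => density_shift j hz)).
  set q := (X in upper_density_le _ X).
  have q3 : q <= 3 * th.
    have q1 : M%:R * b * (1 + L%:R * i0%:R) = th.
      by rewrite /b; field; rewrite !lt0r_neq0.
    have q2 : L%:R * i0%:R * C%:R / M%:R <= th.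
      rewrite ler_pdivrMr// [leRHS]mulrC -ler_pdivrMr//; apply: (le_trans (ltW hM0)).
      by rewrite ler_nat.
    have q4 : L%:R / (5 ^ i0)%:R <= th.
      rewrite ler_pdivrMr ?ltr0n ?expn_gt0// [leRHS]mulrC -ler_pdivrMr//.
      by apply: (le_trans (ltW hi0)); rewrite ler_nat ltnW// ltn_expl.
    have -> : q = M%:R * b * (1 + L%:R * i0%:R) + L%:R * i0%:R * C%:R / M%:R
       + L%:R / (5 ^ i0)%:R by rewrite /q /C; ring.
    by lra.
  case=> K hK; exists K => N.
  apply: le_trans (_ : q * N%:R + K <= _); last by rewrite lerD2r ler_wpM2r.
  apply: le_trans (hK N); rewrite ler_nat; apply: cnt_le => n _ /asboolP nag.
  apply/asboolP; apply: contrapT => /not_orP[/contrapT ag /forall2NP h]; apply: nag.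
  move=> k kL; rewrite iter_shiftE ag; last exact: leq_trans LM.
  by case: (h k) => // /contrapT; rewrite addnC.
have [N1 hN1] := natr_gt (D * K / (eps / 4)).
(* One eps / 4 each for the good times, the bad times, and the constant D * K divided by a large
   N. *)
apply: (@le_lt_trans _ _ (3 * (eps / 4))%:E); last by rewrite lte_fin; lra.
apply: (@limn_esup_le _ _ _ N1.+1) => N NN1; rewrite lee_fin.
have NR : 0 < N%:R :> R by rewrite ltr0n (leq_trans _ NN1).
rewrite mulrC ler_pdivrMr//.
have K1 : D * K <= eps / 4 * N%:R.
  rewrite [leRHS]mulrC -ler_pdivrMr; last lra.
  by apply: (le_trans (ltW hN1)); rewrite ler_nat ltnW.
have D1 : D * (3 * th) = eps / 4 by rewrite /th; field; rewrite lt0r_neq0.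
apply: le_trans (_ : \sum_(n < N) (eps / 4 +
  D * (`[< ~ agree L (iter n left_shift z) (x n) >])%:R) <= _).
  apply: ler_sum => n _; have Yn := YY_iter n Yz; case: asboolP => /= h.
    by rewrite mulr1; apply: le_trans (hD _ _ Yn (xY n)) _; rewrite lerDr; lra.
  by rewrite mulr0 addr0 ltW// hL//; exact: contrapT.
rewrite big_split /= sumr_const card_ord -mulr_sumr -natr_sum -mulr_natr.
have := hK N; rewrite /cnt => /(ler_wpM2l (ltW D0')).
have -> : D * (3 * th * N%:R + K) = D * (3 * th) * N%:R + D * K by ring.
by rewrite D1; lra.
Qed.

End Shadowing.

Theorem corollary28 (R : realType) :
  shift_space YY /\
  forall rho : cantor_space -> cantor_space -> R,
    metric_on YY rho -> compatible_on YY rho ->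
    average_shadowing YY left_shift rho /\ ~ almost_specification YY left_shift rho.
Proof.
split=> [|rho mrho crho]; first exact: shift_space_YY.
by split; [exact: average_shadowing_YY|exact: not_almost_specification].
Qed.
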